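(* Let $(a_n)_{n\ge 0}$ and $(b_n)_{n\ge 0}$ be sequences of complex numbers with $a_n\neq 0$ and $b_n\neq 0$ for all $n$, and let $(x_n)_{n\ge 0}$ be a sequence satisfying $x_{n+2} = a_n x_{n+1} + b_n x_n$ for all $n\ge 0$. Then for every $n = 0,1,2,\dots$, provided the denominators are nonzero, the following identities hold: $$\sum_{k=1}^n \frac{b_k}{a_1a_2\cdots a_k}\frac{x_k}{x_2} = \frac{1}{a_1a_2\cdots a_n}\frac{x_{n+2}}{x_2}-1;$$ $$\sum_{k=1}^n \frac{a_{2k-1}}{b_1b_3\cdots b_{2k-1}}\frac{x_{2k}}{x_1} = \frac{1}{b_1b_3\cdots b_{2n-1}}\frac{x_{2n+1}}{x_1}-1;$$ $$\sum_{k=1}^n \frac{a_{2k}}{b_2b_4\cdots b_{2k}}\frac{x_{2k+1}}{x_2} = \frac{1}{b_2b_4\cdots b_{2n}}\frac{x_{2n+2}}{x_2}-1;$$ $$\sum_{k=1}^n \frac{a_{k}}{b_1b_2\cdots b_{k}}\frac{x_{k+1}^2}{x_1x_2} = \frac{1}{b_1b_2\cdots b_{n}}\frac{x_{n+1}x_{n+2}}{x_1x_2}-1;$$ $$\sum_{k=1}^n (-1)^k \frac{a_1a_2\cdots a_{k-1}}{b_1b_2\cdots b_{k}}\frac{x_{k+2}}{x_1} = (-1)^n\frac{a_1a_2\cdots a_{n}}{b_1b_2\cdots b_{n}}\frac{x_{n+1}}{x_1}-1;$$ $$\sum_{k=1}^n \frac{b_{k-1}b_k}{a_{k-1}} \prod_{j=1}^k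 \left[ \frac{a_{j-1}}{a_{j-1}a_j+b_j}\right] \frac{x_{k-1}}{x_2} = 1-\prod_{j=1}^n \left[ \frac{a_{j-1}}{a_{j-1}a_j+b_j}\right] \frac{x_{n+2}}{x_2}.$$
   Context: Empty products (e.g. $a_1\cdots a_{k-1}$ when $k=1$, or any product over an empty index range when $n=0$) are taken to equal $1$, and empty sums equal $0$. *)

(* Defs.v *)
From mathcomp Require Import all_boot all_order all_algebra.
From mathcomp Require Import complex reals.

Set Implicit Arguments.
Unset Strict Implicit.
Unset Printing Implicit Defensive.

(* Main.v *)
(* In each identity the k-th summand is, by the recurrence, the difference of
   the values at k and k - 1 of the right-hand side, so the sum telescopes. *)

Require Import Defs.
From mathcomp Require Import all_boot all_order all_algebra.
From mathcomp Require Import complex reals.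
From mathcomp Require Import ring zify.
Import Order.TTheory GRing.Theory Num.Theory.
Local Open Scope ring_scope.
Local Open Scope complex_scope.

(** All six sums telescope: [T m] is the non-constant part of the right-hand side at [m] (negated in
    the sixth), and its empty products make [T 0] equal to 1 (to -1 in the sixth). In the first four
    identities the recurrence expands the new term of [T k.+1]; dividing by the newest [a] or [b]
    turns one half into [T k] and leaves the other as the summand. The fifth uses the recurrence to
    recombine two terms, the sixth uses it twice. [sum1_telescope] reduces each identity to this
    one-step check, which [field] settles. *)

(** The bound [k < n] is kept in the step because the denominators of the sixth identity are known
    to be nonzero only up to index [n]. *)
Lemma sum1_telescope {V : zmodType} {u T : nat -> V} {c : V} {n : nat} :
  T 0 = c -> (forall k, (k < n)%N -> u k.+1 = T k.+1 - T k) ->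
  \sum_(1 <= k < n.+1) u k = T n - c.
Proof. by move=> <- uT; rewrite big_add1; apply: telescope_sumr_eq. Qed.

Lemma prod_neq0 {F : fieldType} {c : nat -> F} (m n : nat) :
  (forall j, c j != 0) -> \prod_(m <= j < n) c j != 0.
Proof. by move=> c0; rewrite prodf_seq_neq0; apply/allP => j _; apply: c0. Qed.

Theorem theorem2 (R : realType) (a b x : nat -> R[i])
  (ha : forall n : nat, a n <> 0)
  (hb : forall n : nat, b n <> 0)
  (hx : forall n : nat, x n.+2 = a n * x n.+1 + b n * x n)
  (n : nat) :
  (x 2%N <> 0 ->
     \sum_(1 <= k < n.+1) b k / (\prod_(1 <= j < k.+1) a j) * (x k / x 2%N)
     = 1 / (\prod_(1 <= j < n.+1) a j) * (x (n + 2)%N / x 2%N) - 1) /\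
  (x 1%N <> 0 ->
     \sum_(1 <= k < n.+1)
        a (2 * k - 1)%N / (\prod_(1 <= j < k.+1) b (2 * j - 1)%N)
          * (x (2 * k)%N / x 1%N)
     = 1 / (\prod_(1 <= j < n.+1) b (2 * j - 1)%N)
          * (x (2 * n + 1)%N / x 1%N) - 1) /\
  (x 2%N <> 0 ->
     \sum_(1 <= k < n.+1)
        a (2 * k)%N / (\prod_(1 <= j < k.+1) b (2 * j)%N)
          * (x (2 * k + 1)%N / x 2%N)
     = 1 / (\prod_(1 <= j < n.+1) b (2 * j)%N)
          * (x (2 * n + 2)%N / x 2%N) - 1) /\
  (x 1%N <> 0 -> x 2%N <> 0 ->
     \sum_(1 <= k < n.+1)
        a k / (\prod_(1 <= j < k.+1) b j)
          * (x (k + 1)%N ^+ 2 / (x 1%N * x 2%N))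
     = 1 / (\prod_(1 <= j < n.+1) b j)
          * (x (n + 1)%N * x (n + 2)%N / (x 1%N * x 2%N)) - 1) /\
  (x 1%N <> 0 ->
     \sum_(1 <= k < n.+1)
        (-1) ^+ k
          * ((\prod_(1 <= j < k) a j) / (\prod_(1 <= j < k.+1) b j))
          * (x (k + 2)%N / x 1%N)
     = (-1) ^+ n
          * ((\prod_(1 <= j < n.+1) a j) / (\prod_(1 <= j < n.+1) b j))
          * (x (n + 1)%N / x 1%N) - 1) /\
  (x 2%N <> 0 ->
   (forall j : nat, (1 <= j <= n)%N -> a (j - 1)%N * a j + b j <> 0) ->
     \sum_(1 <= k < n.+1)
        b (k - 1)%N * b k / a (k - 1)%N
          * (\prod_(1 <= j < k.+1)
               (a (j - 1)%N / (a (j - 1)%N * a j + b j)))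
          * (x (k - 1)%N / x 2%N)
     = 1 - (\prod_(1 <= j < n.+1)
               (a (j - 1)%N / (a (j - 1)%N * a j + b j)))
          * (x (n + 2)%N / x 2%N)).
Proof.
have a0 k : a k != 0 by apply/eqP.
have b0 k : b k != 0 by apply/eqP.
split; [move=> /eqP x2|split; [move=> /eqP x1|split; [move=> /eqP x2|
  split; [move=> /eqP x1 /eqP x2|split; [move=> /eqP x1|move=> /eqP x2 c0]]]]].
- apply: (sum1_telescope
    (T := fun m => 1 / (\prod_(1 <= j < m.+1) a j) * (x (m + 2)%N / x 2%N))).
    by rewrite big_geq // divr1 divff // mulr1.
  move=> k _; rewrite big_nat_recr //= !addn2 (hx k.+1).
  have P0 := prod_neq0 1 k.+1 a0.
  by field; rewrite P0 a0 x2.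
- apply: (sum1_telescope
    (T := fun m => 1 / (\prod_(1 <= j < m.+1) b (2 * j - 1)%N)
                   * (x (2 * m + 1)%N / x 1%N))).
    by rewrite big_geq // divr1 divff // mulr1.
  move=> k _; rewrite big_nat_recr //=.
  have P0 := prod_neq0 1 k.+1 (fun j => b0 (2 * j - 1)%N).
  (* The longer index expressions go first, since rewriting [2 * k.+1] would destroy them. *)
  have -> : (2 * k.+1 - 1 = (2 * k).+1)%N by lia.
  have -> : (2 * k.+1 + 1 = (2 * k).+3)%N by lia.
  have -> : (2 * k.+1 = (2 * k).+2)%N by lia.
  rewrite addn1 (hx (2 * k).+1).
  by field; rewrite P0 b0 x1.
- apply: (sum1_telescope
    (T := fun m => 1 / (\prod_(1 <= j < m.+1) b (2 * j)%N)
                   * (x (2 * m + 2)%N / x 2%N))).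
    by rewrite big_geq // divr1 divff // mulr1.
  move=> k _; rewrite big_nat_recr //=.
  have P0 := prod_neq0 1 k.+1 (fun j => b0 (2 * j)%N).
  have -> : (2 * k.+1 = (2 * k).+2)%N by lia.
  rewrite !addn2 addn1 (hx (2 * k).+2).
  by field; rewrite P0 b0 x2.
- apply: (sum1_telescope
    (T := fun m => 1 / (\prod_(1 <= j < m.+1) b j)
                   * (x (m + 1)%N * x (m + 2)%N / (x 1%N * x 2%N)))).
    by rewrite big_geq // divr1 divff ?mulf_neq0 // mulr1.
  (* Here the recurrence is multiplied by [x k.+2]: its [a] half gives the square and its [b] half
     gives [T k]. *)
  move=> k _; rewrite big_nat_recr //= !addn2 !addn1 (hx k.+1).
  have P0 := prod_neq0 1 k.+1 b0.
  by field; rewrite P0 b0 x1 x2.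
- apply: (sum1_telescope
    (T := fun m => (-1) ^+ m
             * ((\prod_(1 <= j < m.+1) a j) / (\prod_(1 <= j < m.+1) b j))
             * (x (m + 1)%N / x 1%N))).
    by rewrite !big_geq // divr1 divff // !mulr1.
  (* Fixing [k.+1] splits only the products up to [k.+1]; those up to [k] may be empty and must stay
     whole. The sign makes [T k.+1 - T k] a sum, which the recurrence collapses to [x k.+3]. *)
  move=> k _; rewrite !(big_nat_recr k.+1) //= addn2 !addn1 (hx k.+1) exprS.
  have P0 := prod_neq0 1 k.+1 b0.
  by field; rewrite P0 b0 x1.
- pose P m := \prod_(1 <= j < m.+1) (a (j - 1)%N / (a (j - 1)%N * a j + b j)).
  (* The right-hand side becomes [T n - (-1)], the form required for telescoping with [c = -1]. *)
  rewrite -/(P n) [RHS]addrC -[X in _ + X]opprK.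
  apply: (sum1_telescope (T := fun m => - (P m * (x (m + 2)%N / x 2%N)))).
    by rewrite /P big_geq // divff // mulr1.
  (* Eliminating [x k.+1] between two instances of the recurrence gives [a k * x k.+3 = (a k * a
     k.+1 + b k.+1) * x k.+2 - b k * b k.+1 * x k]. *)
  move=> k kn; rewrite /P big_nat_recr //= !addn2 subn1 /= (hx k.+1) (hx k).
  have /eqP := c0 k.+1 kn; rewrite subn1 /= => c1.
  by field; rewrite a0 c1 x2.
Qed.
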